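(* Let $n\ge 2$ be even, let $\mathscr{C}_H\subseteq\mathbb{F}_2^{2^n-1}$ be the $[2^n-1,\,2^n-1-n,\,3]$ Hamming code, and let $\mathbf{v}_1,\ldots,\mathbf{v}_{|\mathcal{C}_e|}$ be the elements of its subset $\mathcal{C}_e$ of even-weight codewords. Let $\mathbf{u}\in\mathbb{F}_2^{2^n-1}$ be the punctured truth table of a bent function $f_{\mathbf{u}}:\mathbb{F}_2^n\to\{0,1\}$ with $f_{\mathbf{u}}(\mathbf{0})=0$. Then the cut vector $$\mathbf{z}=\bigl[(-1)^{\mathbf{u}\cdot\mathbf{v}_1},(-1)^{\mathbf{u}\cdot\mathbf{v}_2},\ldots,(-1)^{\mathbf{u}\cdot\mathbf{v}_{|\mathcal{C}_e|}}\bigr]^\top$$ defines an optimal parity assignment for $\mathcal{C}_e$: for $\{\mathbf{p},\bar{\mathbf{p}}\}\in\{P_e,P_o\}$, the assignment giving $\mathbf{v}_i$ the parity $\mathbf{p}$ if $z_i=+1$ and $\bar{\mathbf{p}}$ if $z_i=-1$ is optimal for $\mathcal{C}_e$.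
   Context: The $[2^n-1,\,2^n-1-n,\,3]$ Hamming code is the kernel over $\mathbb{F}_2$ of the $n\times(2^n-1)$ matrix $H$ whose columns are all the nonzero vectors of $\mathbb{F}_2^n$, listed in lexicographic order; every non-codeword is at Hamming distance $1$ from exactly one codeword. $\mathcal{C}_o$ is the set of odd-weight codewords. The punctured truth table of $f:\mathbb{F}_2^n\to\{0,1\}$ is the vector in $\mathbb{F}_2^{2^n-1}$ listing the values $f(\mathbf{x})$ for nonzero $\mathbf{x}$ in lexicographic order. A function $f:\mathbb{F}_2^n\to\{0,1\}$ is bent if $\bigl|\sum_{\mathbf{x}\in\mathbb{F}_2^n}(-1)^{f(\mathbf{x})+\mathbf{a}\cdot\mathbf{x}}\bigr|=2^{n/2}$ for all $\mathbf{a}\in\mathbb{F}_2^n$. $\mathbf{u}\cdot\mathbf{v}$ is the $\mathbb{F}_2$ inner product; a bar on a bit vector denotes bitwise complement. Let $P_e=\{00,11\}$ and $P_o=\{01,10\}$, and let $\{P,P'\}=\{P_e,P_o\}$. Given parity assignments $a:\mathcal{C}_e\to P$ and $b:\mathcal{C}_o\to P'$, let $\mathbf{p}_{a,b}:\mathbb{F}_2^{2^n-1}\to\mathbb{F}_2^2$ equal $a$ on $\mathcal{C}_e$, $b$ on $\mathcal{C}_o$, and on a non-codeword equal the bitwise complement of the parity of its unique nearest codeword. Let $\mathrm{Enc}_{a,b}(\mathbf{x})=(\mathbf{x},\mathbf{p}_{a,b}(\mathbf{x}))$ and let $N_2(a,b)$ be the number of unordered pairs of distinct $\mathbf{x},\mathbf{y}\in\mathbb{F}_2^{2^n-1}$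 with $d_H(\mathrm{Enc}_{a,b}(\mathbf{x}),\mathrm{Enc}_{a,b}(\mathbf{y}))=2$, where $d_H$ is Hamming distance. A parity assignment $a:\mathcal{C}_e\to P$ is optimal for $\mathcal{C}_e$ if $N_2(a,b)\le N_2(a',b)$ for all $a':\mathcal{C}_e\to P$ and all $b:\mathcal{C}_o\to P'$. *)

(* Defs.v *)
From HB Require Import structures.
From mathcomp Require Import all_boot all_order all_algebra.

Set Implicit Arguments.
Unset Strict Implicit.
Unset Printing Implicit Defensive.

Import Order.TTheory GRing.Theory Num.Theory.
Local Open Scope ring_scope.

Section Vectors.
Variable N : nat.
Implicit Types x y : 'rV['F_2]_N.

Definition wt x : nat := #|[set i | x 0 i != 0]|.

Definition dH x y : nat := #|[set i | x 0 i != y 0 i]|.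

Definition dot x y : 'F_2 := \sum_i x 0 i * y 0 i.

Definition compl x : 'rV['F_2]_N := x + const_mx 1.

Definition lex_le x y : bool :=
  let bits (z : 'rV['F_2]_N) : seqlexi nat := [seq (z 0 i : nat) | i <- enum 'I_N] in
  (bits x <= bits y)%O.

End Vectors.

(* (-1)^b for a bit b: elements of 'F_2 coerce to the naturals 0 and 1. *)
Definition signF2 (b : 'F_2) : int := (-1) ^+ b.

Section Hamming.
Variable n : nat.

Definition nz_seq : seq 'rV['F_2]_n :=
  sort (@lex_le n) (enum [pred x : 'rV['F_2]_n | x != 0]).

(* This list has size 2 ^ n - 1, see [size_nz_seq] below, so the default value
   of [nth] is never used. *)
Definition nz_vec (j : 'I_(2 ^ n - 1)) : 'rV['F_2]_n := nth 0 nz_seq j.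

Definition Hmat : 'M['F_2]_(n, 2 ^ n - 1) := \matrix_(i, j) nz_vec j 0 i.

Definition hamming : {set 'rV['F_2]_(2 ^ n - 1)} := [set x | Hmat *m x^T == 0].

Definition Ce : {set 'rV['F_2]_(2 ^ n - 1)} := [set c in hamming | ~~ odd (wt c)].

Definition Co : {set 'rV['F_2]_(2 ^ n - 1)} := [set c in hamming | odd (wt c)].

Definition punctured_tt (f : 'rV['F_2]_n -> 'F_2) : 'rV['F_2]_(2 ^ n - 1) :=
  \row_j f (nz_vec j).

(* The right-hand side is 2^(n/2) for even n, the only case in which this
   definition is meant to be used. *)
Definition bent (f : 'rV['F_2]_n -> 'F_2) : Prop :=
  forall a : 'rV['F_2]_n, `|\sum_x signF2 (f x + dot a x)| = 2 ^+ n./2.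

(* A minimiser of the distance to the code; [0] is a codeword, as required of
   the starting point of [arg min]. *)
Definition nearest (x : 'rV['F_2]_(2 ^ n - 1)) : 'rV['F_2]_(2 ^ n - 1) :=
  [arg min_(c < 0 in hamming) dH x c].

(* Parity assignments are total functions of which only the restriction to
   [Ce] (for [a]) and to [Co] (for [b]) is ever used. *)
Definition parity (a b : 'rV['F_2]_(2 ^ n - 1) -> 'rV['F_2]_2)
    (x : 'rV['F_2]_(2 ^ n - 1)) : 'rV['F_2]_2 :=
  let on_code c := if c \in Ce then a c else b c in
  if x \in hamming then on_code x else compl (on_code (nearest x)).

Definition Enc (a b : 'rV['F_2]_(2 ^ n - 1) -> 'rV['F_2]_2)
    (x : 'rV['F_2]_(2 ^ n - 1)) : 'rV['F_2]_(2 ^ n - 1 + 2) :=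
  row_mx x (parity a b x).

Definition N2 (a b : 'rV['F_2]_(2 ^ n - 1) -> 'rV['F_2]_2) : nat :=
  #|[set e : {set 'rV['F_2]_(2 ^ n - 1)} | [exists x, exists y,
      [&& e == [set x; y], x != y & dH (Enc a b x) (Enc a b y) == 2%N]]]|.

(* [P] is the value set for [Ce], and [P'] the one for [Co]. *)
Definition optimal_for_Ce (P P' : {set 'rV['F_2]_2})
    (a : 'rV['F_2]_(2 ^ n - 1) -> 'rV['F_2]_2) : Prop :=
  {in Ce, forall c, a c \in P} /\
  forall a' b : 'rV['F_2]_(2 ^ n - 1) -> 'rV['F_2]_2,
    {in Ce, forall c, a' c \in P} -> {in Co, forall c, b c \in P'} ->
    (N2 a b <= N2 a' b)%N.

Definition cut_vector (v : 'I_#|Ce| -> 'rV['F_2]_(2 ^ n - 1))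
    (u : 'rV['F_2]_(2 ^ n - 1)) : 'cV[int]_#|Ce| :=
  \col_i signF2 (dot u (v i)).

Lemma size_nz_seq : size nz_seq = (2 ^ n - 1)%N.
Proof.
rewrite size_sort -cardE (@eq_card _ _ (predC1 0)) // cardC1 card_mx card_Fp //.
by rewrite mul1n subn1.
Qed.

End Hamming.

Definition bits2 (s t : 'F_2) : 'rV['F_2]_2 :=
  \row_i (if i == 0 then s else t).

Definition Pe : {set 'rV['F_2]_2} := [set bits2 0 0; bits2 1 1].

Definition Po : {set 'rV['F_2]_2} := [set bits2 0 1; bits2 1 0].

(* Main.v *)
Require Import Defs.
From HB Require Import structures.
From mathcomp Require Import all_boot all_order all_algebra.
From mathcomp Require Import zify ring lra.

Set Implicit Arguments.
Unset Strict Implicit.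
Unset Printing Implicit Defensive.

Import Order.TTheory GRing.Theory Num.Theory.
Local Open Scope ring_scope.

(** A pair at distance 2 whose nearest codewords both lie in [Ce] consists of
    two non-codewords with equal parities; all the other pairs contribute to
    [N2] an amount that does not depend on [a].  Writing [Z] for the signs of
    [a] on [Ce], extended by 0, minimising [N2] thus amounts to minimising the
    quadratic form of the convolution operator on F_2^N, N = 2^n - 1, whose
    kernel counts the [(i, j, k, l)] with k <> l such that
    e_i + e_j + e_k + e_l is a codeword.  Its eigenvalue at the character [u]
    is, up to constants independent of [u], the fourth moment of the spectrum
    g(a) = \sum_j (-1)^(u_j + a.h_j), where h_j are the nonzero vectors.

    One has \sum g = 0 and \sum g^2 = q (q - 1), where q = 2^n, and the values
    of [g] are odd and congruent to each other mod 4.  Put m = 2^(n/2).  After a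
    change of sign of [g], all t = g + 1 are congruent to m mod 4, and then
    (t^2 - m^2)(t^2 - 4t - m^2) >= 0, since this quartic is negative only
    between m and m + 4 and between -m and -m + 2.  Summing over [a]
    bounds the fourth moment from below, with equality when t = m or t = -m
    everywhere, that is, for a bent function. *)

(** * Arithmetic and signs over F_2 *)

Lemma F2P (b : 'F_2) : b = 0 \/ b = 1.
Proof. by case: b => [[|[|//]] ?]; [left|right]; apply: val_inj. Qed.

Lemma F2_addrr (b : 'F_2) : b + b = 0.
Proof. by case: (F2P b) => ->; apply: val_inj. Qed.

Lemma signF2D (b c : 'F_2) : signF2 (b + c) = signF2 b * signF2 c.
Proof. by case: (F2P b) => ->; case: (F2P c) => ->. Qed.

Lemma signF2_cases (b : 'F_2) : signF2 b = 1 \/ signF2 b = -1.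
Proof. by case: (F2P b) => ->; [left|right]. Qed.

Lemma rV2_addrr k (x : 'rV['F_2]_k) : x + x = 0.
Proof. by apply/rowP => i; rewrite !mxE F2_addrr. Qed.

Lemma rV2_oppr k (x : 'rV['F_2]_k) : - x = x.
Proof. by apply/esym/eqP; rewrite -addr_eq0 rV2_addrr. Qed.

Lemma rV2_add_eq0 k (x y : 'rV['F_2]_k) : (x + y == 0) = (x == y).
Proof. by rewrite addr_eq0 rV2_oppr. Qed.

(** * Characters of F_2^k *)

Section Characters.
Variable k : nat.
Implicit Types a x y : 'rV['F_2]_k.

Definition chi a x : int := signF2 (dot a x).

Lemma dotC x y : dot x y = dot y x.
Proof. by apply: eq_bigr => i _; rewrite mulrC. Qed.

Lemma dotDr a x y : dot a (x + y) = dot a x + dot a y.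
Proof. by rewrite -big_split; apply: eq_bigr => i _; rewrite mxE mulrDr. Qed.

Lemma dot_delta a i : dot a (delta_mx 0 i) = a 0 i.
Proof.
rewrite /dot (bigD1 i) //= big1 => [|j ji]; rewrite !mxE ?eqxx ?mulr1 ?addr0 //.
by rewrite (negPf ji) andbF mulr0.
Qed.

Lemma chiC x y : chi x y = chi y x.
Proof. by rewrite /chi dotC. Qed.

Lemma chiD a x y : chi a (x + y) = chi a x * chi a y.
Proof. by rewrite /chi dotDr signF2D. Qed.

Lemma chi_delta a i : chi a (delta_mx 0 i) = signF2 (a 0 i).
Proof. by rewrite /chi dot_delta. Qed.

Lemma chi_sqr a x : chi a x * chi a x = 1.
Proof. by rewrite /chi; case: (signF2_cases (dot a x)) => ->. Qed.

Lemma chi0 a : chi a 0 = 1.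
Proof. by rewrite -(rV2_addrr 0) chiD chi_sqr. Qed.

(** If [x] has a nonzero entry [i], translating [a] by the unit vector at [i] flips the sign of
    every term. *)
Lemma sum_chi x : \sum_a chi a x = (x == 0)%:R * 2 ^+ k.
Proof.
have [->|x0] := eqVneq x 0.
  rewrite (eq_bigr (fun=> 1)) => [|a _]; last exact: chi0.
  by rewrite sumr_const card_mx card_Fp // mul1n mul1r natrX.
have [i xi] : exists i, x 0 i = 1.
  have [i xi] := rV0Pn _ x0; exists i.
  by case: (F2P (x 0 i)) xi => -> //; rewrite eqxx.
rewrite mul0r; set S := LHS.
suff : S = - S by lia.
rewrite {1}/S (reindex_inj (addrI (delta_mx 0 i))) /= -sumrN.
apply: eq_bigr => a _.
by rewrite chiC chiD chi_delta xi mulN1r chiC.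
Qed.

End Characters.

Lemma sum_mulr_pair (R : comRingType) (I J : finType) (F : I -> R) (G : J -> R) :
  (\sum_i F i) * (\sum_j G j) = \sum_(p : I * J) F p.1 * G p.2.
Proof. by rewrite big_distrlr /= pair_big. Qed.

(** * Spectral bound for convolution forms *)

Section QuadraticForm.
Variables (k : nat) (T : finType) (e : T -> 'rV['F_2]_k) (m : T -> int).

(** The Fourier coefficient of the measure with mass [m t] at [e t], hence the eigenvalue at [chi u]
    of convolution with it. *)
Definition eigen (u : 'rV['F_2]_k) : int := \sum_t m t * chi u (e t).

Definition fourier (Z : 'rV['F_2]_k -> int) u : int := \sum_x Z x * chi u x.

Lemma fourier_sqr (Z : 'rV['F_2]_k -> int) u :
  fourier Z u ^+ 2 = \sum_x \sum_y Z x * Z y * chi u (x + y).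
Proof.
rewrite expr2 /fourier big_distrlr /=; apply: eq_bigr => x _; apply: eq_bigr => y _.
by rewrite chiD mulrACA.
Qed.

(** The squared transform is inverted into the autocorrelation; Parseval is the case [t = 0]. *)
Lemma sum_fourier_sqr (Z : 'rV['F_2]_k -> int) t :
  \sum_u fourier Z u ^+ 2 * chi u t = 2 ^+ k * \sum_x Z x * Z (x + t).
Proof.
under eq_bigr => u _ do rewrite fourier_sqr big_distrl /=.
rewrite exchange_big mulr_sumr; apply: eq_bigr => x _ /=.
under eq_bigr => u _ do rewrite big_distrl /=.
rewrite exchange_big (bigD1 (x + t)) //= [X in _ + X]big1 => [|y yx].
  rewrite addr0 (eq_bigr (fun u => Z x * Z (x + t))) => [|u _].
    by rewrite sumr_const card_mx card_Fp // mul1n -[LHS]mulr_natl natrX.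
  by rewrite -mulrA -chiD addrA rV2_addrr add0r rV2_addrr chi0 mulr1.
rewrite (eq_bigr (fun u => Z x * Z y * chi u (x + y + t))) => [|u _].
  rewrite -mulr_sumr sum_chi addrAC rV2_add_eq0 eq_sym (negPf yx).
  by rewrite mul0r mulr0.
by rewrite -mulrA -chiD.
Qed.

(** The Fourier transform diagonalises the form: up to the factor [2 ^+ k] both sides are sums of
    [fourier Z u ^+ 2], weighted by [L] and by [eigen u]. *)
Lemma quadratic_form_ge (L : int) (Z : 'rV['F_2]_k -> int) :
  (forall u, L <= eigen u) ->
  L * \sum_x Z x ^+ 2 <= \sum_x \sum_t m t * (Z x * Z (x + e t)).
Proof.
move=> Lu.
have pos : 0 < 2 ^+ k :> int by apply: exprn_gt0.
rewrite -(ler_pM2l pos).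
have -> : 2 ^+ k * (\sum_x \sum_t m t * (Z x * Z (x + e t))) =
          \sum_u fourier Z u ^+ 2 * eigen u.
  rewrite exchange_big mulr_sumr /=.
  under [RHS]eq_bigr => u _ do rewrite /eigen mulr_sumr.
  rewrite [RHS]exchange_big; apply: eq_bigr => t _ /=.
  rewrite -mulr_sumr mulrCA -sum_fourier_sqr mulr_sumr.
  by apply: eq_bigr => u _; rewrite mulrCA.
have -> : 2 ^+ k * (L * \sum_x Z x ^+ 2) = \sum_u fourier Z u ^+ 2 * L.
  rewrite -mulr_suml mulrCA mulrC; congr (_ * _).
  transitivity (2 ^+ k * \sum_x Z x * Z (x + 0)).
    by congr (_ * _); apply: eq_bigr => x _; rewrite addr0 expr2.
  by rewrite -sum_fourier_sqr; apply: eq_bigr => u _; rewrite chi0 mulr1.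
by apply: ler_sum => u _; rewrite ler_wpM2l ?sqr_ge0.
Qed.

End QuadraticForm.

(** * Ordered versus unordered pairs *)

Section PairCount.
Variable T : finType.

Lemma sum_pairs_set2 (A : {set T}) :
  \sum_(p : T * T) ((p.1 != p.2) && (A == [set p.1; p.2]))%:R
    = (#|A| == 2%N)%:R * 2 :> int.
Proof.
have [/eqP/cards2P[x] [y] [xy ->]|A2] := eqVneq #|A| 2%N; last first.
  rewrite mul0r big1 // => p _; case: eqVneq => //= p12.
  by case: eqP => // AE; rewrite AE cards2 p12 in A2.
rewrite (bigD1 (x, y)) //= (bigD1 (y, x)) /=; last first.
  by rewrite xpair_eqE negb_and eq_sym xy.
rewrite !eqxx xy eq_sym xy setUC eqxx big1 // => -[z w] /=.
rewrite !xpair_eqE => /andP[n1 n2]; case: eqVneq => //= zw.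
case: eqP => // E; exfalso.
have: z \in [set y; x] by rewrite E set21.
have: w \in [set y; x] by rewrite E set22.
rewrite !inE => /orP[]/eqP wE /orP[]/eqP zE; subst;
  by rewrite ?eqxx in n1 n2 zw.
Qed.
End PairCount.

(** * A quartic inequality on a residue class modulo 4 *)

Lemma quartic_ge0 (h r : int) : 0 <= h ->
  let m := 2 * h in let t := m + 4 * r in
  0 <= (t ^+ 2 - m ^+ 2) * (t ^+ 2 - 4 * t - m ^+ 2).
Proof.
move=> h0 /=.
(* With s = r + h the last factor is 2rs - r - s = r(s - 1) + s(r - 1). For nonzero integers r and s
   its sign is never opposite to that of rs, whence the case split on r and s. *)
have -> : ((2 * h + 4 * r) ^+ 2 - (2 * h) ^+ 2) *
    ((2 * h + 4 * r) ^+ 2 - 4 * (2 * h + 4 * r) - (2 * h) ^+ 2) =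
  128 * (r * (r + h)) * (2 * (r * (r + h)) - h - 2 * r) by ring.
have [r1|[->|r1]] : 1 <= r \/ r = 0 \/ r <= -1 by lia.
- by apply: mulr_ge0; nia.
- by rewrite mul0r !mulr0 mul0r.
have [r2|[->|r2]] : 1 <= r + h \/ r + h = 0 \/ r + h <= -1 by lia.
- by apply: mulr_le0; nia.
- by rewrite !mulr0 mul0r.
by apply: mulr_ge0; nia.
Qed.

(** * Enumeration of the nonzero vectors *)

Section NonzeroVectors.
Variable n : nat.

Lemma mem_nz_seq (x : 'rV['F_2]_n) : (x \in nz_seq n) = (x != 0).
Proof. by rewrite mem_sort mem_enum. Qed.

Lemma nz_vec_neq0 (j : 'I_(2 ^ n - 1)) : nz_vec j != 0.
Proof. by rewrite -mem_nz_seq mem_nth // size_nz_seq. Qed.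

Lemma nz_vec_inj : injective (@nz_vec n).
Proof.
move=> i j /eqP; rewrite nth_uniq ?size_nz_seq ?sort_uniq ?enum_uniq //.
by move/eqP/val_inj.
Qed.

Lemma nz_vec_surj (x : 'rV['F_2]_n) : x != 0 -> exists j, nz_vec j = x.
Proof.
rewrite -mem_nz_seq => xs.
have lt : (index x (nz_seq n) < 2 ^ n - 1)%N by rewrite -size_nz_seq index_mem.
by exists (Ordinal lt); rewrite /nz_vec nth_index.
Qed.

Lemma sum_nz_vec (F : 'rV['F_2]_n -> int) :
  \sum_j F (nz_vec j) = \sum_x F x - F 0.
Proof.
rewrite [in RHS](bigD1 0) //= [F 0 + _]addrC addrK.
transitivity (\sum_(x <- nz_seq n) F x).
  by rewrite (big_nth 0) size_nz_seq big_mkord.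
rewrite (perm_big _ (permEl (perm_sort _ _))) big_enum.
by apply: eq_bigl.
Qed.

End NonzeroVectors.

(** * Moments and residues of the spectrum *)

Section Spectrum.
Variables (n : nat) (u : 'rV['F_2]_(2 ^ n - 1)).
Implicit Types a : 'rV['F_2]_n.

(** The Walsh transform of a function with punctured truth table [u], without its term at 0. *)
Definition spectrum a : int := \sum_j signF2 (u 0 j) * chi a (nz_vec j).

Lemma sum_spectrum : \sum_a spectrum a = 0.
Proof.
rewrite exchange_big big1 // => j _ /=.
by rewrite -mulr_sumr sum_chi (negPf (nz_vec_neq0 j)) mul0r mulr0.
Qed.

Lemma spectrum_sqr a : spectrum a ^+ 2 =
  \sum_p signF2 (u 0 p.1 + u 0 p.2) * chi a (nz_vec p.1 + nz_vec p.2).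
Proof.
rewrite expr2 sum_mulr_pair; apply: eq_bigr => p _.
by rewrite chiD signF2D mulrACA.
Qed.

Lemma spectrum_pow4 a : spectrum a ^+ 4 =
  \sum_t signF2 (u 0 t.1.1 + u 0 t.1.2 + (u 0 t.2.1 + u 0 t.2.2)) *
    chi a (nz_vec t.1.1 + nz_vec t.1.2 + (nz_vec t.2.1 + nz_vec t.2.2)).
Proof.
rewrite (exprM _ 2 2) expr2 spectrum_sqr sum_mulr_pair.
by apply: eq_bigr => p _; rewrite [in RHS]chiD [in RHS]signF2D mulrACA.
Qed.

Lemma sum_spectrum_sqr :
  \sum_a spectrum a ^+ 2 = 2 ^+ n * (2 ^+ n - 1).
Proof.
under eq_bigr => a _ do rewrite spectrum_sqr.
rewrite exchange_big /=.
under eq_bigr => p _ do rewrite -mulr_sumr sum_chi rV2_add_eq0.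
rewrite -(pair_bigA _ (fun i j => signF2 (u 0 i + u 0 j) *
  ((nz_vec i == nz_vec j)%:R * 2 ^+ n))) /=.
rewrite (eq_bigr (fun=> 2 ^+ n)) => [|i _].
  rewrite sumr_const card_ord -[LHS]mulr_natr natrB ?expn_gt0 //.
  by rewrite natrX.
rewrite (bigD1 i) //= big1 => [|j ji].
  by rewrite F2_addrr eqxx !mul1r addr0.
by rewrite (inj_eq (@nz_vec_inj n)) eq_sym (negPf ji) mul0r mulr0.
Qed.

Lemma sum_spectrum_pow4 :
  \sum_a spectrum a ^+ 4 = 2 ^+ n *
    \sum_t (nz_vec t.1.1 + nz_vec t.1.2 + (nz_vec t.2.1 + nz_vec t.2.2) == 0)%:R *
     signF2 (u 0 t.1.1 + u 0 t.1.2 + (u 0 t.2.1 + u 0 t.2.2)).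
Proof.
under eq_bigr => a _ do rewrite spectrum_pow4.
rewrite exchange_big mulr_sumr; apply: eq_bigr => t _ /=.
by rewrite -mulr_sumr sum_chi mulrCA mulrA [RHS]mulrCA mulrA mulrAC.
Qed.

(** Modulo 4, the term at [j] is [chi a (nz_vec j) - 2 * u 0 j]. The characters sum to -1 or to
    [2 ^+ n - 1] over the nonzero vectors, and 4 divides [2 ^+ n], so the residue does not depend on
    [a]. *)
Lemma spectrum_mod4 : (2 <= n)%N ->
  exists w : int, forall a, exists r : int, spectrum a = 2 * w - 1 + 4 * r.
Proof.
move=> n2; exists (- (\sum_j (u 0 j : nat)%:Z)) => a.
have E (j : 'I_(2 ^ n - 1)) : exists r : int, signF2 (u 0 j) * chi a (nz_vec j) =
    chi a (nz_vec j) - 2 * (u 0 j : nat)%:Z + 4 * r.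
  case: (F2P (u 0 j)) => ->; last first.
    case: (signF2_cases (dot a (nz_vec j))); rewrite /chi => ->.
      by exists 0.
    by exists 1.
  by exists 0; rewrite mul1r mulr0 subr0 addr0.
have [r rE] := fin_all_exists E.
have [q qE] : exists q : int, 2 ^+ n = 4 * q :> int.
  by exists (2 ^+ (n - 2)); rewrite -{1}(subnK n2) exprD mulrC.
exists ((a == 0)%:R * q + \sum_j r j).
rewrite /spectrum (eq_bigr _ (fun j _ => rE j)) !big_split /=.
rewrite sum_nz_vec chi0 sumrN -!mulr_sumr.
have -> : \sum_x chi a x = (a == 0)%:R * 2 ^+ n.
  by rewrite -sum_chi; apply: eq_bigr => x _; rewrite chiC.
rewrite qE; move: (\sum_j r j) (\sum_j (u 0 j : nat)%:Z) => R W; ring.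
Qed.

End Spectrum.

(** * Bent functions minimise the fourth moment *)

Section BentMinimizes.
Variable n : nat.

Lemma sqr_pow2_half : ~~ odd n -> (2 ^+ n./2) ^+ 2 = 2 ^+ n :> int.
Proof. by move=> n_even; rewrite -exprM muln2 even_halfK. Qed.

(** The term -4t in the second factor cancels the cubic term in the spectrum, so that only moments
    known for every [u] accompany the fourth one. *)
Lemma sum_shifted_quartic (u : 'rV['F_2]_(2 ^ n - 1)) (e m : int) :
  e ^+ 2 = 1 -> m ^+ 2 = 2 ^+ n ->
  \sum_a (let t := e * spectrum u a + 1 in
          (t ^+ 2 - m ^+ 2) * (t ^+ 2 - 4 * t - m ^+ 2)) =
  \sum_a spectrum u a ^+ 4 - 2 ^+ n * (2 ^+ n - 1) * (2 ^+ n + 3).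
Proof.
move=> e2 mq /=.
rewrite (eq_bigr (fun a => spectrum u a ^+ 4 + - (2 * 2 ^+ n + 6) * spectrum u a ^+ 2
   + (- 8 * e) * spectrum u a + (2 ^+ n + 3) * (2 ^+ n - 1))) => [|a _]; last first.
  by rewrite mq; move/eqP: e2; rewrite sqrf_eq1 => /orP[]/eqP->; ring.
rewrite !big_split /= -!mulr_sumr sum_spectrum_sqr sum_spectrum.
rewrite sumr_const card_mx card_Fp // mul1n -[_ *+ (2 ^ n)]mulr_natl natrX.
ring.
Qed.

Lemma spectrum_pow4_ge (u : 'rV['F_2]_(2 ^ n - 1)) : (2 <= n)%N -> ~~ odd n ->
  2 ^+ n * (2 ^+ n - 1) * (2 ^+ n + 3) <= \sum_a spectrum u a ^+ 4.
Proof.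
move=> n2 n_even; have [h hE h0] : exists2 h : int, 2 ^+ n./2 = 2 * h :> int & 0 <= h.
  exists (2 ^+ (n./2).-1); last exact: exprn_ge0.
  by rewrite -exprS prednK // half_gt0.
have [w wE] := spectrum_mod4 u n2.
(* Modulo 4, [spectrum u a + 1] is 2w and [1 - spectrum u a] is 2(1 - w). One of w and 1 - w has the
   parity of h, which selects the sign. *)
have [e e2 eE] : exists2 e : int, e ^+ 2 = 1 &
    forall a, exists r, e * spectrum u a + 1 = 2 * h + 4 * r.
  have [[k kE]|[k kE]] : (exists k, w - h = 2 * k) \/ (exists k, 1 - w - h = 2 * k).
  - have [kE|kE] : w - h = 2 * ((w - h) %/ 2)%Z \/ w - h = 2 * ((w - h) %/ 2)%Z + 1.
      lia.
      by left; eexists; exact: kE.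
    by right; exists (- h - ((w - h) %/ 2)%Z); lia.
  - exists 1 => // a; have [r ->] := wE a; exists (k + r); lia.
  - exists (- 1) => // a; have [r ->] := wE a; exists (k - r); lia.
rewrite -subr_ge0 -(sum_shifted_quartic u e2 (sqr_pow2_half n_even)).
apply: sumr_ge0 => a _ /=; have [r ->] := eE a.
by rewrite hE; apply: quartic_ge0.
Qed.

Lemma bent_spectrum_pow4 (f : 'rV['F_2]_n -> 'F_2) : ~~ odd n -> bent f -> f 0 = 0 ->
  \sum_a spectrum (punctured_tt f) a ^+ 4 = 2 ^+ n * (2 ^+ n - 1) * (2 ^+ n + 3).
Proof.
move=> n_even f_bent f0; apply/eqP; rewrite -subr_eq0.
rewrite -(sum_shifted_quartic _ (expr1n _ 2) (sqr_pow2_half n_even)) big1 // => a _ /=.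
(* The term at 0 missing from the spectrum is 1 because [f 0 = 0]. So t is a Walsh coefficient of
   [f], and bentness makes the factor t^2 - m^2 vanish. *)
have -> : 1 * spectrum (punctured_tt f) a + 1 = \sum_x signF2 (f x + dot a x).
  rewrite mul1r /spectrum.
  under eq_bigr => j _ do rewrite mxE -signF2D.
  rewrite (sum_nz_vec (fun x => signF2 (f x + dot a x))) f0 add0r.
  by rewrite [signF2 _]chi0 subrK.
by rewrite -(real_normK (num_real (\sum_x _))) f_bent subrr mul0r.
Qed.

End BentMinimizes.

(** * Weight parity and words at small distance *)

Section Distance.
Variable k : nat.
Implicit Types x y : 'rV['F_2]_k.

Lemma odd_natr_F2 m : odd m = (m%:R == 1 :> 'F_2).
Proof.
elim: m => // m IHm; rewrite /= IHm mulrS.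
by case: (F2P m%:R) => ->.
Qed.

Lemma odd_wt x : odd (wt x) = (dot (const_mx 1) x == 1).
Proof.
rewrite odd_natr_F2 /wt -sum1_card natr_sum; congr (_ == _).
rewrite big_mkcond; apply: eq_bigr => i _; rewrite inE mxE mul1r.
by case: (F2P (x 0 i)) => ->.
Qed.

Lemma odd_wtD x y : odd (wt (x + y)) = odd (wt x) (+) odd (wt y).
Proof.
rewrite !odd_wt dotDr.
by case: (F2P (dot (const_mx 1) x)) => ->; case: (F2P (dot (const_mx 1) y)) => ->.
Qed.

Lemma odd_wt_delta i : odd (wt (delta_mx 0 i : 'rV['F_2]_k)).
Proof. by rewrite odd_wt dot_delta mxE. Qed.

Lemma dHC x y : dH x y = dH y x.
Proof. by apply: eq_card => i; rewrite !inE eq_sym. Qed.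

Lemma dH_sum x y : dH x y = (\sum_i (x 0%R i != y 0%R i))%N.
Proof.
rewrite /dH -sum1_card big_mkcond; apply: eq_bigr => i _.
by rewrite inE; case: (x 0 i != y 0 i).
Qed.

Lemma dH_eq0 x y : (dH x y == 0)%N = (x == y).
Proof.
rewrite /dH cards_eq0; apply/eqP/eqP => [E|->].
  apply/rowP => i; apply/eqP; rewrite -[_ == _]negbK.
  by have := in_set0 i; rewrite -E inE => ->.
by apply/setP => i; rewrite !inE eqxx.
Qed.

Lemma diff_set1 x y i :
  [set l | x 0 l != y 0 l] = [set i] -> y = x + delta_mx 0 i.
Proof.
move=> E; apply/rowP => l; have := in_set1 l i; rewrite -E !inE !mxE eqxx /=.
by case: (l == i); case: (F2P (x 0 l)) => ->; case: (F2P (y 0 l)) => -> // _;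
  apply/eqP.
Qed.

Lemma diff_set2 x y i j : i != j ->
  ([set l | x 0 l != y 0 l] == [set i; j])
    = (y == x + (delta_mx 0 i + delta_mx 0 j)).
Proof.
move=> ij; apply/eqP/eqP => [E|->].
  apply/rowP => l; have := in_set2 l i j; rewrite -E !inE !mxE eqxx /=.
  by case: (F2P (x 0 l)) => ->; case: (F2P (y 0 l)) => ->;
    case: (eqVneq l i) => [->|_]; rewrite ?(negPf ij) //; case: (_ == j) => // _;
    apply/eqP.
apply/setP => l; rewrite !inE !mxE eqxx /=.
by case: (F2P (x 0 l)) => ->; case: (eqVneq l i) => [->|_]; rewrite ?(negPf ij) //;
  case: (_ == j).
Qed.

Lemma dH1P x y : dH x y = 1%N -> exists i, y = x + delta_mx 0 i.
Proof. by move/eqP/cards1P => [i /diff_set1 E]; exists i. Qed.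

Lemma dH2P x y : dH x y = 2%N ->
  exists i j, i != j /\ y = x + (delta_mx 0 i + delta_mx 0 j).
Proof.
move/eqP/cards2P => [i] [j] [ij /eqP]; rewrite diff_set2 // => /eqP E.
by exists i, j.
Qed.

(** The factor 2 appears because each word at distance 2 from [x] comes from the two orders of its
    pair of flipped positions. *)
Lemma sum_dH2 (F : 'rV['F_2]_k -> int) x :
  2 * \sum_y (dH x y == 2%N)%:R * F y =
  \sum_p (p.1 != p.2)%:R * F (x + (delta_mx 0 p.1 + delta_mx 0 p.2)).
Proof.
rewrite mulr_sumr.
rewrite (eq_bigr (fun y => \sum_p ((p.1 != p.2) &&
    ([set l | x 0 l != y 0 l] == [set p.1; p.2]))%:R * F y)) => [|y _]; last first.
  by rewrite -mulr_suml sum_pairs_set2 mulrCA mulrA.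
rewrite exchange_big; apply: eq_bigr => p _ /=.
have [p12|p12] := boolP (p.1 != p.2); last first.
  by rewrite mul0r big1 // => y _; rewrite mul0r.
under eq_bigr => y _ do rewrite /= diff_set2 //.
rewrite (bigD1 (x + (delta_mx 0 p.1 + delta_mx 0 p.2))) //= eqxx big1 ?addr0 //.
by move=> y /negPf->; rewrite mul0r.
Qed.

End Distance.

Lemma dH_row_mx k l (x y : 'rV['F_2]_k) (s t : 'rV['F_2]_l) :
  dH (row_mx x s) (row_mx y t) = (dH x y + dH s t)%N.
Proof.
rewrite !dH_sum big_split_ord /=; congr addn; apply: eq_bigr => i _.
  by rewrite !row_mxEl.
by rewrite !row_mxEr.
Qed.

(** * The two classes of parity words *)

Section TwoBits.
Implicit Types s t : 'rV['F_2]_2.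

Definition bit_sum s : 'F_2 := s 0 0 + s 0 1.

Lemma bits2E s : s = bits2 (s 0 0) (s 0 1).
Proof.
apply/rowP => i; rewrite mxE; case: i => [[|[|//]] ?] /=; congr (s 0 _);
  exact: val_inj.
Qed.

Lemma bits2_eq (a b c d : 'F_2) :
  (bits2 a b == bits2 c d) = (a == c) && (b == d).
Proof.
apply/eqP/andP => [/rowP E|[/eqP-> /eqP->] //].
by have := E 0; have := E 1; rewrite !mxE /= => -> ->.
Qed.

Lemma compl_bits2 (a b : 'F_2) : compl (bits2 a b) = bits2 (a + 1) (b + 1).
Proof. by apply/rowP => i; rewrite !mxE; case: ifP. Qed.

Lemma dH_bits2 (a b c d : 'F_2) :
  dH (bits2 a b) (bits2 c d) = ((a != c) + (b != d))%N.
Proof. by rewrite dH_sum !big_ord_recl big_ord0 !mxE /= addn0. Qed.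

Lemma bit_sum_bits2 (a b : 'F_2) : bit_sum (bits2 a b) = a + b.
Proof. by rewrite /bit_sum !mxE. Qed.

Lemma in_Pe s : (s \in Pe) = (bit_sum s == 0).
Proof.
rewrite (bits2E s) !inE !bits2_eq bit_sum_bits2.
by case: (F2P (s 0 0)) => ->; case: (F2P (s 0 1)) => ->.
Qed.

Lemma in_Po s : (s \in Po) = (bit_sum s == 1).
Proof.
rewrite (bits2E s) !inE !bits2_eq bit_sum_bits2.
by case: (F2P (s 0 0)) => ->; case: (F2P (s 0 1)) => ->.
Qed.

Lemma bit_sum_compl s : bit_sum (compl s) = bit_sum s.
Proof.
by rewrite /bit_sum !mxE addrACA F2_addrr addr0.
Qed.

Lemma complK s : compl (compl s) = s.
Proof. by rewrite /compl -addrA rV2_addrr addr0. Qed.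

Lemma compl_neq s : compl s != s.
Proof.
rewrite (bits2E s) compl_bits2 bits2_eq.
by case: (F2P (s 0 0)) => ->; case: (F2P (s 0 1)) => ->.
Qed.

Lemma bit_sum_eqP s t : bit_sum s = bit_sum t -> s = t \/ s = compl t.
Proof.
rewrite (bits2E s) (bits2E t) compl_bits2 !bit_sum_bits2 => /eqP E.
suff /orP[/eqP->|/eqP->] : (bits2 (s 0 0) (s 0 1) == bits2 (t 0 0) (t 0 1)) ||
    (bits2 (s 0 0) (s 0 1) == bits2 (t 0 0 + 1) (t 0 1 + 1)); [by left|by right|].
rewrite !bits2_eq; move: E.
by case: (F2P (s 0 0)) => ->; case: (F2P (s 0 1)) => ->;
  case: (F2P (t 0 0)) => ->; case: (F2P (t 0 1)) => ->.
Qed.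

Lemma dH_bit_sum s t :
  dH s t = if bit_sum s == bit_sum t then if s == t then 0%N else 2%N else 1%N.
Proof.
rewrite (bits2E s) (bits2E t) !bit_sum_bits2 dH_bits2 bits2_eq.
by case: (F2P (s 0 0)) => ->; case: (F2P (s 0 1)) => ->;
  case: (F2P (t 0 0)) => ->; case: (F2P (t 0 1)) => ->.
Qed.

Lemma parity_classes (P P' : {set 'rV['F_2]_2}) : [set P; P'] = [set Pe; Po] ->
  exists eps, (forall s, (s \in P) = (bit_sum s == eps)) /\
              (forall s, (s \in P') = (bit_sum s == eps + 1)).
Proof.
move=> E.
have neq : Pe != Po.
  apply/eqP => /setP/(_ (bits2 0 0)).
  by rewrite in_Pe in_Po bit_sum_bits2.
have P_in : P \in [set Pe; Po] by rewrite -E set21.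
have e_in : Pe \in [set P; P'] by rewrite E set21.
have o_in : Po \in [set P; P'] by rewrite E set22.
move: P_in e_in o_in; rewrite !inE => /orP[]/eqP-> .
  rewrite eqxx (eq_sym Po) (negPf neq) => _ /eqP<-.
  by exists 0; split; [exact: in_Pe|rewrite add0r; exact: in_Po].
rewrite eqxx (negPf neq) => /eqP<- _.
exists 1; split; [exact: in_Po|by move=> s; rewrite F2_addrr; exact: in_Pe].
Qed.

End TwoBits.

(** * The Hamming code and its convolution operator *)

Section HammingCode.
Variable n : nat.
Local Notation I := 'I_(2 ^ n - 1).
Local Notation V := 'rV['F_2]_(2 ^ n - 1).
Local Notation e := (@delta_mx 'F_2 1 (2 ^ n - 1) 0).
Implicit Types x y c : V.

Definition syndrome x : 'rV['F_2]_n := x *m (Hmat n)^T.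

Lemma syndromeD x y : syndrome (x + y) = syndrome x + syndrome y.
Proof. exact: mulmxDl. Qed.

Lemma syndrome_delta (i : I) : syndrome (e i) = nz_vec i.
Proof. by rewrite /syndrome -rowE; apply/rowP => j; rewrite !mxE. Qed.

Lemma in_hamming x : (x \in hamming n) = (syndrome x == 0).
Proof.
by rewrite inE /syndrome -(inj_eq (@trmx_inj _ _ _)) trmx_mul trmxK trmx0.
Qed.

Lemma in_Ce x : (x \in Ce n) = (syndrome x == 0) && ~~ odd (wt x).
Proof. by rewrite inE in_hamming. Qed.

Lemma hamming_delta x (i j : I) : x + e i \in hamming n -> x + e j \in hamming n -> i = j.
Proof.
rewrite !in_hamming !syndromeD !rV2_add_eq0 !syndrome_delta => /eqP-> /eqP.
exact: nz_vec_inj.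
Qed.

(** The syndrome of [x] is nonzero, hence a column of [Hmat]; flipping that position gives a
    codeword, so the minimal distance is 1. *)
Lemma nearest_delta x : x \notin hamming n ->
  nearest x \in hamming n /\ exists i, nearest x = x + e i.
Proof.
move=> xH; have zero_in : (0 : V) \in hamming n by rewrite in_hamming /syndrome mul0mx.
rewrite /nearest; case: arg_minnP => // c cH c_min; split=> //.
apply: dH1P; apply/eqP; rewrite eqn_leq lt0n dH_eq0 [_ != _](_ : _ = true); last first.
  by apply: contraNneq xH => ->.
have [i iE] : exists i : I, nz_vec i = syndrome x.
  by apply: nz_vec_surj; rewrite -in_hamming.
rewrite andbT; apply: leq_trans (c_min (x + e i) _) _.
  by rewrite in_hamming syndromeD syndrome_delta iE rV2_addrr.
apply: (@leq_trans #|[set i]|); last by rewrite cards1.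
apply: subset_leq_card; apply/subsetP => l.
rewrite !inE !mxE eqxx /=; case: (eqVneq l i) => // _.
by rewrite addr0 eqxx.
Qed.

Lemma Ce_addr c x : c \in Ce n -> (c + x \in Ce n) = (x \in Ce n).
Proof.
rewrite !in_Ce syndromeD odd_wtD => /andP[/eqP-> /negPf->].
by rewrite add0r.
Qed.

Definition neighbour_sum (Z : V -> int) x : int := \sum_i Z (x + e i).

(** A codeword has no codeword at distance 1, any other word exactly one. The value at the nearest
    codeword thus becomes linear and translation-invariant in [Z], which turns the count into a
    convolution form. *)
Lemma neighbour_sumE (Z : V -> int) x :
  (forall c, c \notin hamming n -> Z c = 0) ->
  neighbour_sum Z x = if x \in hamming n then 0 else Z (nearest x).
Proof.
move=> Z0; case: ifP => [xH|/negbT xH].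
  apply: big1 => i _; apply: Z0; rewrite in_hamming syndromeD.
  move: xH; rewrite in_hamming => /eqP->.
  by rewrite add0r syndrome_delta nz_vec_neq0.
have [cH [i ci]] := nearest_delta xH.
rewrite /neighbour_sum (bigD1 i) //= -ci big1 ?addr0 // => j ji.
apply: Z0; apply: contraNN ji => jH; rewrite ci in cH.
by rewrite (hamming_delta jH cH).
Qed.

Notation T := ((I * I) * (I * I))%type.

(** For [t = ((i, j), (k, l))]: the total step of a path from a codeword along [e i] to a word x,
    along [e k + e l] to a word y at distance 2 from x if k and l differ, then along [e j] to a
    codeword. *)
Definition sum4 (t : T) : V := e t.1.1 + e t.1.2 + (e t.2.1 + e t.2.2).

Definition weight4 (t : T) : int :=
  (t.2.1 != t.2.2)%:R * (syndrome (sum4 t) == 0)%:R.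

Lemma syndrome_sum4 t : syndrome (sum4 t) =
  nz_vec t.1.1 + nz_vec t.1.2 + (nz_vec t.2.1 + nz_vec t.2.2).
Proof. by rewrite !syndromeD !syndrome_delta. Qed.

Lemma chi_sum4 u t : chi u (sum4 t) =
  signF2 (u 0 t.1.1 + u 0 t.1.2 + (u 0 t.2.1 + u 0 t.2.2)).
Proof. by rewrite !chiD !chi_delta !signF2D. Qed.

Lemma sum_neighbours_dH2 (Z : V -> int) :
  (forall c, c \notin Ce n -> Z c = 0) ->
  2 * \sum_x \sum_y (dH x y == 2%N)%:R * (neighbour_sum Z x * neighbour_sum Z y) =
  \sum_x \sum_t weight4 t * (Z x * Z (x + sum4 t)).
Proof.
move=> Z0; rewrite mulr_sumr.
transitivity (\sum_x \sum_(i : I) \sum_(p : I * I) \sum_(j : I) (p.1 != p.2)%:R *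
    (Z (x + e i) * Z (x + (e p.1 + e p.2) + e j))).
  apply: eq_bigr => x _.
  under eq_bigr => y _ do rewrite mulrCA.
  rewrite -mulr_sumr mulrCA sum_dH2 mulr_suml; apply: eq_bigr => i _.
  rewrite mulr_sumr; apply: eq_bigr => p _; rewrite mulrCA.
  by rewrite mulr_sumr mulr_sumr.
transitivity (\sum_x \sum_(i : I) \sum_(p : I * I) \sum_(j : I) (p.1 != p.2)%:R *
    (Z x * Z (x + sum4 ((i, j), p)))).
  rewrite exchange_big [RHS]exchange_big; apply: eq_bigr => i _ /=.
  rewrite (reindex_inj (addIr (e i))); apply: eq_bigr => x _ /=.
  apply: eq_bigr => p _; apply: eq_bigr => j _.
  rewrite -[x + _ + _]addrA rV2_addrr addr0; congr (_ * (_ * Z _)).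
  by rewrite /sum4 /= [e i + _ + _]addrAC !addrA.
apply: eq_bigr => x _.
rewrite -(pair_bigA _ (fun q p => weight4 (q, p) * (Z x * Z (x + sum4 (q, p))))) /=.
rewrite -(pair_bigA _ (fun i j => \sum_p weight4 ((i, j), p) *
   (Z x * Z (x + sum4 ((i, j), p))))) /=.
apply: eq_bigr => i _; rewrite exchange_big; apply: eq_bigr => j _ /=.
apply: eq_bigr => p _; rewrite /weight4 /= -mulrA; congr (_ * _).
(* The syndrome condition in [weight4] costs nothing: a step of nonzero syndrome leaves [Ce], where
   [Z] vanishes. *)
have [_|s0] := eqVneq (syndrome _) 0; first by rewrite mul1r.
rewrite mul0r; have [xC|xC] := boolP (x \in Ce n); last by rewrite Z0 ?mul0r.
by rewrite (Z0 (_ + _)) ?mulr0 // Ce_addr // in_Ce (negPf s0).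
Qed.

(** The fourth moment also counts tuples with k = l. These have zero syndrome only for i = j, and
    then sign 1, so they contribute a constant independent of [u]. *)
Lemma eigen_spectrum u : 2 ^+ n * eigen sum4 weight4 u =
  \sum_a spectrum u a ^+ 4
  - 2 ^+ n * \sum_(t : T) ((t.1.1 == t.1.2) && (t.2.1 == t.2.2))%:R.
Proof.
rewrite sum_spectrum_pow4 -mulrBr; congr (_ * _); rewrite -sumrB.
apply: eq_bigr => t _; rewrite chi_sum4 /weight4 syndrome_sum4.
case: eqVneq => [->|_]; last by rewrite andbF subr0 mul1r.
rewrite !rV2_addrr F2_addrr !addr0 rV2_add_eq0 (inj_eq (@nz_vec_inj n)) andbT.
by case: eqVneq => [->|_]; rewrite ?F2_addrr ?mul0r.
Qed.

Lemma eigen_bent_min (f : 'rV['F_2]_n -> 'F_2) u :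
  (2 <= n)%N -> ~~ odd n -> bent f -> f 0 = 0 ->
  eigen sum4 weight4 (punctured_tt f) <= eigen sum4 weight4 u.
Proof.
move=> n2 n_even f_bent f0.
have pos : 0 < 2 ^+ n :> int by apply: exprn_gt0.
rewrite -(ler_pM2l pos) !eigen_spectrum lerD2r bent_spectrum_pow4 //.
exact: spectrum_pow4_ge.
Qed.

(** A sum of four unit vectors has even weight, so a step of zero syndrome stays in the group [Ce];
    a character cut off to [Ce] is therefore an eigenvector. *)
Lemma character_form u :
  \sum_x \sum_t weight4 t *
    ((x \in Ce n)%:R * chi u x * ((x + sum4 t \in Ce n)%:R * chi u (x + sum4 t)))
  = eigen sum4 weight4 u * \sum_x ((x \in Ce n)%:R * chi u x) ^+ 2.
Proof.
rewrite mulr_sumr; apply: eq_bigr => x _.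
have [xC|xC] := boolP (x \in Ce n); last first.
  by rewrite mul0r expr2 mul0r mulr0 big1 // => t _; rewrite mul0r mulr0.
rewrite !mul1r expr2 chi_sqr mulr1; apply: eq_bigr => t _.
rewrite Ce_addr // in_Ce /weight4.
case: (eqVneq (syndrome _)) => [_|]; last by rewrite !mulr0 !mul0r.
rewrite (_ : odd _ = false); last first.
  by rewrite !odd_wtD !odd_wt_delta.
by rewrite mul1r chiD [chi u x * _]mulrA chi_sqr mul1r.
Qed.

End HammingCode.

(** * From the count of pairs to the quadratic form *)

Section CountingN2.
Variables (n : nat) (p : 'rV['F_2]_2).
Local Notation V := 'rV['F_2]_(2 ^ n - 1).
Implicit Types (x y c : V) (a b : V -> 'rV['F_2]_2).

Lemma sum_N2 a b : (N2 a b)%:Z * 2 =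
  \sum_x \sum_y ((x != y) && (dH (Enc a b x) (Enc a b y) == 2%N))%:R.
Proof.
rewrite pair_bigA /=.
pose R (q : V * V) := dH (Enc a b q.1) (Enc a b q.2) == 2%N.
transitivity (\sum_(q : V * V) \sum_(E : {set V})
   ((q.1 != q.2) && (E == [set q.1; q.2]))%:R * (R q)%:R : int); last first.
  apply: eq_bigr => q _; rewrite -/(R q).
  rewrite (bigD1 [set q.1; q.2]) //= big1 => [|E /negPf->]; last first.
    by rewrite andbF mul0r.
  by rewrite eqxx andbT addr0; case: (_ != _); case: (R q).
rewrite exchange_big /N2 -natz -sum1_card natr_sum mulr_suml [LHS]big_mkcond /=.
apply: eq_bigr => E _; rewrite inE; case: ifPn => [|noE].
  move=> /existsP[x] /existsP[y] /and3P[/eqP EE xy d].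
  have -> : 1%:R * 2 = (#|E| == 2%N)%:R * 2 :> int by rewrite EE cards2 xy.
  rewrite -sum_pairs_set2; apply: eq_bigr => -[z w] _ /=.
  case: eqVneq => [|zw]; first by rewrite mul0r.
  rewrite EE; case: eqP => [Ezw|_]; last by rewrite mul0r.
  suff -> : R (z, w) by rewrite mul1r.
  have: z \in [set x; y] by rewrite Ezw set21.
  have: w \in [set x; y] by rewrite Ezw set22.
  rewrite !inE => /orP[]/eqP wE /orP[]/eqP zE; subst;
    by rewrite ?eqxx // /R /= ?d // dHC d in zw *.
rewrite big1 // => -[z w] _ /=.
have [zw|] := boolP ((z != w) && _); last by rewrite mul0r.
case: (boolP (R _)) => Rzw; last by rewrite mulr0.
case/negP: noE; apply/existsP; exists z; apply/existsP; exists w.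
by case/andP: zw => -> ->.
Qed.

Definition center x : V := if x \in hamming n then x else nearest x.

Lemma center_hamming x : center x \in hamming n.
Proof.
by rewrite /center; case: ifP => // /negbT/nearest_delta[].
Qed.

Lemma center_Co x : center x \notin Ce n -> center x \in Co n.
Proof.
by have := center_hamming x; rewrite !inE => -> /=; rewrite negbK.
Qed.

Lemma parityE a b x : parity a b x =
  let s := if center x \in Ce n then a (center x) else b (center x) in
  if x \in hamming n then s else compl s.
Proof. by rewrite /parity /center; case: ifP. Qed.

(** Were [x] a codeword, [y] would have even weight and nonzero syndrome, so its nearest codeword,
    one flip away, would have odd weight. *)
Lemma dist2_notin_hamming x y : dH x y = 2%N ->
  center x \in Ce n -> center y \in Ce n -> x \notin hamming n.
Proof.
move=> /dH2P[i [j [ij yE]]] xC yC; apply/negP => xH.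
move: xC; rewrite /center xH in_Ce => /andP[/eqP sx wx].
have sy : syndrome y = nz_vec i + nz_vec j.
  by rewrite yE !syndromeD !syndrome_delta sx add0r.
have wy : ~~ odd (wt y) by rewrite yE !odd_wtD !odd_wt_delta (negPf wx).
have yH : y \notin hamming n.
  by rewrite in_hamming sy rV2_add_eq0 (inj_eq (@nz_vec_inj n)).
move: yC; rewrite /center (negPf yH).
have [_ [k ->]] := nearest_delta yH.
by rewrite in_Ce odd_wtD odd_wt_delta (negPf wy) andbF.
Qed.

Definition sign_on_Ce a c : int :=
  (c \in Ce n)%:R * (if a c == p then 1 else -1).

Lemma sign_on_Ce0 a c : c \notin Ce n -> sign_on_Ce a c = 0.
Proof. by rewrite /sign_on_Ce => /negPf->; rewrite mul0r. Qed.

Lemma sign_on_Ce_sqr a c : sign_on_Ce a c ^+ 2 = (c \in Ce n)%:R.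
Proof. by rewrite /sign_on_Ce; case: (c \in Ce n); case: ifP. Qed.

Lemma neighbour_sum_sign a x : neighbour_sum (sign_on_Ce a) x =
  if x \in hamming n then 0 else sign_on_Ce a (center x).
Proof.
rewrite neighbour_sumE /center; first by case: ifP.
by move=> c cH; rewrite /sign_on_Ce inE (negPf cH) mul0r.
Qed.

(** The part of twice the pair indicator that is free of [a]. For two centers in [Ce], the indicator
    of equal signs z, z' is (1 + z z') / 2, which leaves the 1. For one center in [Ce], the parities
    lie in different classes, at distance 1. For none, only [b] is evaluated. *)
Definition residue b x y : int :=
  if (center x \in Ce n) && (center y \in Ce n) then (dH x y == 2%N)%:R
  else 2 * ((x != y) && (dH x y + (if (center x \in Ce n) || (center y \in Ce n)
     then 1 else dH (parity b b x) (parity b b y)) == 2)%N)%:R.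

Lemma distance2_term a b x y :
  {in Ce n, forall c, bit_sum (a c) = bit_sum p} ->
  {in Co n, forall c, bit_sum (b c) = bit_sum p + 1} ->
  2 * ((x != y) && (dH (Enc a b x) (Enc a b y) == 2%N))%:R =
  (dH x y == 2%N)%:R *
    (neighbour_sum (sign_on_Ce a) x * neighbour_sum (sign_on_Ce a) y)
  + residue b x y.
Proof.
move=> aP bP'; rewrite /residue dH_row_mx.
have par z : bit_sum (parity a b z) = bit_sum p + (center z \notin Ce n)%:R.
  rewrite parityE /=; case: ifP => _; rewrite ?bit_sum_compl;
  by case: ifPn => zC; rewrite ?aP ?addr0 // bP' // center_Co.
have par_b z : center z \notin Ce n -> parity a b z = parity b b z.
  by rewrite !parityE /= => /negPf->.
have nb z : center z \notin Ce n -> neighbour_sum (sign_on_Ce a) z = 0.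
  by move=> zC; rewrite neighbour_sum_sign sign_on_Ce0 //; case: ifP.
have [xC|xC] := boolP (center x \in Ce n); have [yC|yC] := boolP (center y \in Ce n);
  rewrite /=.
- rewrite dH_bit_sum !par xC yC eqxx.
  (* Parities in one class are at distance 0 or 2, so distinct words contribute only when they are
     themselves at distance 2. *)
  have [d2|d2] := eqVneq (dH x y) 2%N; last first.
    rewrite mul0r addr0; case: ifP => _; first by rewrite addn0 (negPf d2) andbF.
    by rewrite (eqn_add2r 2 _ 0) dH_eq0 andNb.
  have xH := dist2_notin_hamming d2 xC yC.
  have yH : y \notin hamming n by apply: dist2_notin_hamming yC xC; rewrite dHC.
  have -> : x != y by rewrite -dH_eq0 d2.
  rewrite !neighbour_sum_sign (negPf xH) (negPf yH) /sign_on_Ce xC yC !mul1r.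
  rewrite !parityE /= xC yC (negPf xH) (negPf yH) d2.
  rewrite (inj_eq (can_inj complK)).
  have pc : (compl p == p) = false := negPf (compl_neq p).
  case: (bit_sum_eqP (aP _ xC)) => ->; case: (bit_sum_eqP (aP _ yC)) => ->;
  by rewrite ?eqxx ?pc ?[p == compl p]eq_sym ?pc.
- by rewrite (nb y) // !mulr0 add0r dH_bit_sum !par xC yC (inj_eq (addrI _)).
- by rewrite (nb x) // mul0r mulr0 add0r dH_bit_sum !par xC yC (inj_eq (addrI _)).
- by rewrite (nb x) // mul0r mulr0 add0r !par_b.
Qed.

Definition sign_form a : int :=
  \sum_x \sum_t weight4 t * (sign_on_Ce a x * sign_on_Ce a (x + sum4 t)).

(** The 8 collects three doublings: ordered pairs, the half in the indicator of equal signs, and the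
    ordered pairs of flipped positions. *)
Lemma N2_sign_form a b :
  {in Ce n, forall c, bit_sum (a c) = bit_sum p} ->
  {in Co n, forall c, bit_sum (b c) = bit_sum p + 1} ->
  8 * (N2 a b)%:Z = sign_form a + 2 * \sum_x \sum_y residue b x y.
Proof.
move=> aP bP'.
rewrite /sign_form -(sum_neighbours_dH2 (@sign_on_Ce0 a)) -mulrDr -big_split /=.
have -> : 8 * (N2 a b)%:Z = 2 * (2 * ((N2 a b)%:Z * 2)) by ring.
rewrite sum_N2; congr (_ * _); rewrite mulr_sumr; apply: eq_bigr => x _.
rewrite mulr_sumr -big_split; apply: eq_bigr => y _.
exact: distance2_term.
Qed.

End CountingN2.

(** * Comparison of the bent assignment with an arbitrary one *)

Theorem theorem5 (n : nat) (n_ge2 : (2 <= n)%N) (n_even : ~~ odd n)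
    (v : 'I_#|Ce n| -> 'rV['F_2]_(2 ^ n - 1)) (v_inj : injective v)
    (v_enum : [set v i | i : 'I_#|Ce n|] = Ce n)
    (f : 'rV['F_2]_n -> 'F_2) (f_bent : bent f) (f0 : f 0 = 0)
    (u : 'rV['F_2]_(2 ^ n - 1)) (u_tt : u = punctured_tt f)
    (P P' : {set 'rV['F_2]_2}) (PP' : [set P; P'] = [set Pe; Po])
    (p : 'rV['F_2]_2) (pP : [set p; compl p] = P)
    (a : 'rV['F_2]_(2 ^ n - 1) -> 'rV['F_2]_2)
    (a_plus : forall i, cut_vector v u i 0 = 1 -> a (v i) = p)
    (a_minus : forall i, cut_vector v u i 0 = -1 -> a (v i) = compl p) :
  optimal_for_Ce P P' a.
Proof.
have a_chi c : c \in Ce n -> a c = if chi u c == 1 then p else compl p.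
  rewrite -v_enum => /imsetP[i _ ->].
  have := a_plus i; have := a_minus i; rewrite mxE -/(chi u (v i)).
  by case: (signF2_cases (dot u (v i))); rewrite /chi => -> m q; [exact: q|exact: m].
have aP : {in Ce n, forall c, a c \in P}.
  by move=> c /a_chi->; rewrite -pP; case: ifP; rewrite ?set21 ?set22.
split=> // a' b a'P bP'.
have [eps [inP inP']] := parity_classes PP'.
have pE : bit_sum p = eps by apply/eqP; rewrite -inP -pP set21.
have N2E := @N2_sign_form n p _ b.
have bE : {in Co n, forall c, bit_sum (b c) = bit_sum p + 1}.
  by move=> c /bP'; rewrite inP' pE => /eqP.
have sE a1 : {in Ce n, forall c, a1 c \in P} ->
    {in Ce n, forall c, bit_sum (a1 c) = bit_sum p}.
  by move=> a1P c /a1P; rewrite inP pE => /eqP.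
suff form_le : sign_form p a <= sign_form p a'.
  have := N2E a (sE a aP) bE; have := N2E a' (sE a' a'P) bE; lia.
have sign_a c : sign_on_Ce p a c = (c \in Ce n)%:R * chi u c.
  rewrite /sign_on_Ce; have [cC|_] := boolP (c \in Ce n); last by rewrite !mul0r.
  rewrite a_chi //; congr (_ * _); case: (signF2_cases (dot u c)); rewrite /chi => -> /=.
    by rewrite eqxx.
  by rewrite (negPf (compl_neq p)).
(* The signs of [a] are the character [chi u] cut off to [Ce], so the form takes the value
   eigenvalue times squared norm. The squared norm is the size of [Ce] for every assignment, so that
   of [a'] may replace it. *)
have -> : sign_form p a =
    eigen (@sum4 n) (@weight4 n) u * \sum_c sign_on_Ce p a' c ^+ 2.
  rewrite /sign_form; under eq_bigr => x _ do under eq_bigr => t _ do rewrite !sign_a.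
  rewrite character_form; congr (_ * _); apply: eq_bigr => c _.
  by rewrite -sign_a !sign_on_Ce_sqr.
apply: quadratic_form_ge => w; rewrite u_tt.
exact: eigen_bent_min.
Qed.
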